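(* Let $\sigma\ge0$, let $\varsigma>0$ and assume that $f\in L^1_{\mathrm{loc}}(\mathbb R)$ satisfies the following conditions: (i) $\displaystyle\sup_{s\in\mathbb R}\int_s^{s+\delta}f(u)\,du\to0$ as $\delta\to0^+$; (ii) $f(t)-\sigma\ge\varsigma$ for a.e. $t\in\mathbb R$. Then the displacement map $\Psi\colon\mathbb R\to\mathbb R$ corresponding to the LIF model driven by $f$ is bounded and uniformly continuous. Moreover, $\inf_{t\in\mathbb R}\Psi(t)>0$.
   Context: LIF model: for $\sigma\ge0$ and $f\in L^1_{\mathrm{loc}}(\mathbb R)$, the leaky integrate-and-fire (LIF) model driven by $f$ is $\dot x(t)=-\sigma x(t)+f(t)$ for a.e. $t\in\mathbb R$, with the resetting condition: $x(s)=1\Rightarrow\lim_{t\to s^+}x(t)=0$. Firing map: $\Phi(t)=\inf\{t_*>t : e^{\sigma t}\le\int_t^{t_*}(f(u)-\sigma)e^{\sigma u}\,du\}$; $\Phi(t)$ is well-defined (defined) if this set is non-empty. Displacement map: $\Psi(t)=\Phi(t)-t$, defined for those $t$ for which $\Phi(t)$ is well-defined. *)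

(* Defs.v *)
From HB Require Import structures.
From mathcomp Require Import all_boot all_order all_algebra.
From mathcomp Require Import all_classical all_reals all_analysis.

Set Implicit Arguments.
Unset Strict Implicit.
Unset Printing Implicit Defensive.
Import Order.TTheory GRing.Theory Num.Theory.
Import numFieldNormedType.Exports.
Local Open Scope classical_set_scope.
Local Open Scope ring_scope.

Section LIF.
Context {R : realType}.
Implicit Types (sigma t : R) (f : R -> R).

(* By variation of constants, the solution of x' = - sigma x + f with x t = 0
   and no reset satisfies 1 <= x t' iff
   expR (sigma * t') <= \int_t^t' f u * expR (sigma * u) du; subtracting
   \int_t^t' sigma * expR (sigma * u) du from both sides gives the inequality
   below. *)
Definition firing_set sigma f t : set R :=
  [set t' | t < t' /\
     expR (sigma * t) <=
     \int[lebesgue_measure]_(u in `[t, t']) ((f u - sigma) * expR (sigma * u))].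

Definition firing_defined sigma f t : Prop := firing_set sigma f t !=set0.

(* Meaningful only where [firing_defined] holds: [inf set0] is 0. *)
Definition firing_map sigma f t : R := inf (firing_set sigma f t).

Definition displacement_map sigma f t : R := firing_map sigma f t - t.

End LIF.

(* Main.v *)
Require Import Defs.
From HB Require Import structures.
From mathcomp Require Import all_boot all_order all_algebra.
From mathcomp Require Import all_classical all_reals all_analysis.
From mathcomp Require Import measurable_realfun ring lra.
Set Implicit Arguments.
Unset Strict Implicit.
Unset Printing Implicit Defensive.
Import Order.TTheory GRing.Theory Num.Theory.
Import numFieldNormedType.Exports.
Local Open Scope classical_set_scope.
Local Open Scope ring_scope.

(** Write [J a b] ([net_input] below) for the integral over [[a, b]] of
    [(f u - sigma) * expR (sigma * u)], so that the firing set at [t] consists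
    of the [t' > t] with [expR (sigma * t) <= J t t'].  The theorem follows from
    comparing [J] with two simpler quantities.

    From below, [f - sigma >= varsigma] gives
    [J a b >= varsigma * expR (sigma * a) * (b - a)] ([net_input_ge]).  Hence
    [t + varsigma^-1] always lies in the firing set, which shows that the firing
    map is defined everywhere and that the displacement lies between [0] and
    [varsigma^-1].

    From above, [J a b] is at most [expR (sigma * b)] times the integral of [f]
    ([net_input_le]), and the latter is small on short intervals, uniformly in
    their position.  Relative to [expR (sigma * s)], the sum of [J s t] and of
    the growth [expR (sigma * t) - expR (sigma * s)] of the threshold is thus
    uniformly small when [t - s] is ([net_input_small]).  Two consequences:

    - [J t t'] cannot reach [expR (sigma * t)] while [t' - t] is below some [d]
      that does not depend on [t], so the displacement is at least [d];

    - for [s <= t], the firing map [Phi] satisfies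
      [0 <= Phi t - Phi s <= (t - s) + e], where [e] is arbitrarily small for
      [t - s] small.  It is monotone because starting earlier lowers the
      threshold and increases [J] ([firing_map_homo]).  The other inequality
      holds because starting at [t] instead of [s] loses [J s t] and raises the
      threshold slightly, and, the integrand being bounded below, an extra time
      [e] makes up for both ([firing_map_le_add]).  Subtracting [t - s], the
      displacements at [s] and [t] differ by at most [e] or [t - s].

    All inequalities about the infimum [Phi] come from exhibiting elements or lower
    bounds of the firing set. *)

(** * Integrals of locally integrable functions *)

Lemma ae_le_Rintegral d (T : measurableType d) (R : realType)
    (mu : {measure set T -> \bar R}) (D : set T) (f g : T -> R) :
  measurable D -> mu.-integrable D (EFin \o f) ->
  mu.-integrable D (EFin \o g) -> {ae mu, forall x, D x -> f x <= g x} ->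
  \int[mu]_(x in D) f x <= \int[mu]_(x in D) g x.
Proof.
move=> mD fi gi [N [mN N0 fgN]].
rewrite /Rintegral (negligible_integral mN mD fi N0).
rewrite (negligible_integral mN mD gi N0).
have mDN : measurable (D `\` N) by exact: measurableD.
apply: le_Rintegral => //; [exact: integrableS fi|exact: integrableS gi|].
move=> x [Dx Nx]; apply: contrapT => fgx; apply: Nx; apply: fgN.
by move=> /(_ Dx).
Qed.

Lemma locally_integrable_itvcc (R : realType) (f : R -> R) (a b : R) :
  locally_integrable [set: R] f ->
  lebesgue_measure.-integrable `[a, b] (EFin \o f).
Proof.
move=> [mf _ fi]; apply/integrableP; split.
  by apply/measurable_EFinP; exact: measurable_funS mf.
by apply: fi => //; exact: segment_compact.
Qed.

(** * The net input *)

Section net_input.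
Context {R : realType}.
Notation mu := (@lebesgue_measure R).
Implicit Types (f : R -> R) (sigma a b c : R).

(** Multiplied by [expR (- sigma * b)], this is the value at [b] of the solution
    without reset driven by [f - sigma] and started from [0] at [a]. *)
Definition net_input sigma f a b : R :=
  \int[mu]_(u in `[a, b]) ((f u - sigma) * expR (sigma * u)).

Lemma continuous_expRM sigma : continuous (fun u : R => expR (sigma * u)).
Proof.
by move=> u; apply: continuous_comp; [exact: mulrl_continuous|exact: continuous_expR].
Qed.

Lemma integrable_mul_expR sigma f a b : locally_integrable [set: R] f ->
  mu.-integrable `[a, b] (EFin \o (fun u => f u * expR (sigma * u))).
Proof.
move=> lf.
have H := @integrableMl _ _ _ mu `[a, b] _ (EFin \o f) (fun u => expR (sigma * u)).
apply: H => //; first exact: locally_integrable_itvcc.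
- apply: measurable_funTS; apply: continuous_measurable_fun.
  exact: continuous_expRM.
have /compact_bounded [M [Mr MP]] : compact ((fun u => expR (sigma * u)) @` `[a, b]).
  apply: continuous_compact; last exact: segment_compact.
  by apply: continuous_subspaceT => ?; exact: continuous_expRM.
by exists M; split => // y My x xab; apply: MP => //; exists x.
Qed.

Lemma locally_integrable_sub sigma f : locally_integrable [set: R] f ->
  locally_integrable [set: R] (fun u => f u - sigma).
Proof.
move=> lf; apply: locally_integrableB => //.
split => //; first exact: openT.
move=> K _ cK.
have /integrableP[] // : mu.-integrable K (EFin \o cst sigma).
apply: continuous_compact_integrable => //.
by apply: continuous_subspaceT => x; exact: cvg_cst.
Qed.

Lemma integrable_net_input sigma f a b : locally_integrable [set: R] f ->
  mu.-integrable `[a, b]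
    (EFin \o (fun u => (f u - sigma) * expR (sigma * u))).
Proof. by move=> /(locally_integrable_sub sigma)/integrable_mul_expR; apply. Qed.

Lemma net_inputD sigma f a b c : locally_integrable [set: R] f ->
  a <= b -> b <= c -> net_input sigma f a c = net_input sigma f a b + net_input sigma f b c.
Proof.
move=> lf ab bc; rewrite [X in _ + X]/net_input -Rintegral_itv_obnd_cbnd; last first.
  apply: integrableS (integrable_net_input sigma b c lf) => //.
  exact: subset_itv_oc_cc.
rewrite -(@Rintegral_itvB _ _ (BLeft a)) ?bnd_simp//; last exact: integrable_net_input.
by rewrite addrC subrK.
Qed.

Lemma Rintegral_cst_itvcc a b r : a <= b ->
  \int[mu]_(u in `[a, b]) r = r * (b - a).
Proof.
move=> ab; rewrite Rintegral_cst//= lebesgue_measure_itv/= lte_fin.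
by case: ltgtP ab => // -> _; rewrite subrr.
Qed.

Lemma integrable_cst_itvcc a b r : mu.-integrable `[a, b] (EFin \o cst r).
Proof.
apply: continuous_compact_integrable; first exact: segment_compact.
by apply: continuous_subspaceT => x; exact: cvg_cst.
Qed.

(** On [[a, b]] the weight [expR (sigma * u)] is smallest at [u = a]. *)
Lemma net_input_ge sigma varsigma f a b : 0 <= sigma -> 0 <= varsigma ->
  locally_integrable [set: R] f ->
  {ae mu, forall u, varsigma <= f u - sigma} ->
  a <= b -> varsigma * expR (sigma * a) * (b - a) <= net_input sigma f a b.
Proof.
move=> s0 v0 lf fge ab; rewrite -Rintegral_cst_itvcc//.
apply: ae_le_Rintegral => //.
- exact: integrable_cst_itvcc.
- exact: integrable_net_input.
have F := ae_filter_ringOfSetsType mu.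
apply: filterS fge => u gu; rewrite /= in_itv/= => /andP[au _].
by rewrite ler_pM ?expR_ge0// ler_expR ler_wpM2l.
Qed.

Lemma net_input_ge0 sigma varsigma f a b : 0 <= sigma -> 0 <= varsigma ->
  locally_integrable [set: R] f ->
  {ae mu, forall u, varsigma <= f u - sigma} ->
  a <= b -> 0 <= net_input sigma f a b.
Proof.
move=> s0 v0 lf fge ab; apply: le_trans (net_input_ge s0 v0 lf fge ab).
by rewrite !mulr_ge0 ?expR_ge0 ?subr_ge0.
Qed.

(** On [[a, b]] the weight [expR (sigma * u)] is largest at [u = b], and dropping
    [- sigma] only increases the integrand. *)
Lemma net_input_le sigma f a b : 0 <= sigma ->
  locally_integrable [set: R] f -> {ae mu, forall u, 0 <= f u} ->
  net_input sigma f a b <= expR (sigma * b) * \int[mu]_(u in `[a, b]) f u.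
Proof.
move=> s0 lf f0; rewrite -RintegralZl//; last exact: locally_integrable_itvcc.
apply: ae_le_Rintegral => //.
- exact: integrable_net_input.
- have := integrableZl _ (expR (sigma * b)) (locally_integrable_itvcc a b lf).
  by apply.
have F := ae_filter_ringOfSetsType mu.
apply: filterS f0 => u fu; rewrite /= in_itv/= => /andP[_ ub].
rewrite mulrC; apply: (@le_trans _ _ (expR (sigma * u) * f u)).
  by rewrite ler_wpM2l ?expR_ge0// gerBl.
by rewrite ler_wpM2r// ler_expR ler_wpM2l.
Qed.

End net_input.

(** * Uniform smallness on short intervals *)

(** This is what the supremum condition is used for: the bound [d] on the length
    of the interval does not depend on where the interval lies. *)
Lemma Rintegral_small (R : realType) (f : R -> R) :
  locally_integrable [set: R] f ->
  ereal_sup (range (fun s : R =>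
      (\int[lebesgue_measure]_(u in `[s, (s + delta)%R]) (f u)%:E)%E))
    @[delta --> (0 : R)^'+] --> 0%E ->
  forall e : R, 0 < e -> exists2 d : R, 0 < d & forall s t : R, s <= t -> t - s < d ->
    \int[lebesgue_measure]_(u in `[s, t]) f u < e.
Proof.
move=> lf f_sup e e0.
have : nbhs (0%E : \bar R) [set x | x < e%:E]%E.
  by apply: open_nbhs_nbhs; split; [exact: open_ereal_lt_ereal|rewrite /= lte_fin].
move=> /f_sup[d /= d0 dP]; exists d => // s t.
rewrite le_eqVlt => /predU1P[<- _|st std]; first by rewrite set_itv1 Rintegral_set1.
have ts0 : 0 < t - s by rewrite subr_gt0.
have := dP (t - s); rewrite /= sub0r normrN gtr0_norm// => /(_ std ts0).
rewrite -lte_fin; apply: le_lt_trans; apply: ereal_sup_ubound; exists s => //=.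
by rewrite addrC subrK fineK//; apply: integrable_fin_num => //; exact: locally_integrable_itvcc.
Qed.

Section firing.
Context {R : realType} (sigma varsigma : R) (f : R -> R).
Notation mu := (@lebesgue_measure R).
Context (sigma_ge0 : 0 <= sigma) (varsigma_gt0 : 0 < varsigma)
  (f_loc : locally_integrable [set: R] f)
  (f_ge : {ae mu, forall t, varsigma <= f t - sigma}).

(** After division by [expR (sigma * s)] the exponentials become [1] and
    [expR (sigma * (t - s))], which depend on [t - s] only.  This makes the estimate
    uniform in [s] although the exponential is not uniformly continuous. *)
Lemma net_input_small :
  (forall e : R, 0 < e -> exists2 d : R, 0 < d & forall s t : R, s <= t -> t - s < d ->
    \int[mu]_(u in `[s, t]) f u < e) ->
  forall e : R, 0 < e -> exists2 d : R, 0 < d & forall s t : R, s <= t -> t - s < d ->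
    net_input sigma f s t + expR (sigma * t) - expR (sigma * s) <
    e * expR (sigma * s).
Proof.
move=> f_small e e0.
have [d1 d10 d1P] : exists2 d : R, 0 < d &
    forall x : R, 0 <= x -> x < d -> expR (sigma * x) < 1 + e / 2.
  have : nbhs (expR (sigma * 0)) [set y | y < 1 + e / 2].
    by apply: lt_nbhsl; rewrite mulr0 expR0 ltrDl divr_gt0.
  move=> /continuous_expRM/nbhs_ballP[d /= d0 dP]; exists d => // x x0 xd.
  by apply: (dP x); rewrite /ball/= sub0r normrN ger0_norm.
have k0 : 0 < 1 + e / 2 by rewrite addr_gt0// divr_gt0.
(* [1 + e / 2] bounds the exponential factor in [net_input_le], so that the
   input and the growth of the threshold contribute [e / 2] each. *)
have [|d2 d20 d2P] := f_small (e / 2 / (1 + e / 2)); first by rewrite !divr_gt0.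
exists (Num.min d1 d2); first by rewrite lt_min d10.
move=> s t st; rewrite lt_min => /andP[/d1P exp_lt /d2P -/(_ st) int_lt].
have ts0 : 0 <= t - s by rewrite subr_ge0.
have Et : expR (sigma * t) = expR (sigma * s) * expR (sigma * (t - s)).
  by rewrite -expRD; congr expR; ring.
have f0 : {ae mu, forall u, 0 <= f u}.
  have F := ae_filter_ringOfSetsType mu.
  by apply: filterS f_ge => u /= fu; have := sigma_ge0; have := varsigma_gt0; lra.
have := net_input_le s t sigma_ge0 f_loc f0; rewrite Et.
have := exp_lt ts0.
have := expR_gt0 (sigma * s); have := expR_gt0 (sigma * (t - s)).
move: (expR (sigma * (t - s))) (expR (sigma * s)) => A B A0 B0 AK.
have : A * \int[mu]_(u in `[s, t]) f u < e / 2.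
  apply: (@lt_trans _ _ (A * (e / 2 / (1 + e / 2)))); first by rewrite ltr_pM2l.
  by rewrite mulrCA -[ltRHS]mulr1 ltr_pM2l ?divr_gt0// ltr_pdivrMr// mul1r.
move: (net_input _ _ _ _) (Rintegral _ _ _) => J I AI JI.
have := ltr_pM2l B0 (A * I) (e / 2); rewrite AI.
have := ltr_pM2l B0 A (1 + e / 2); rewrite AK.
move: JI; lra.
Qed.

(** * The firing and displacement maps *)

(** By [net_input_ge], this time suffices for the slowest admissible input
    [varsigma]. *)
Lemma firing_setD t : firing_set sigma f t (t + varsigma^-1).
Proof.
have v0 : 0 < varsigma^-1 by rewrite invr_gt0.
split; first by rewrite ltrDl.
apply: le_trans (net_input_ge sigma_ge0 (ltW varsigma_gt0) f_loc f_ge _); last first.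
  by rewrite lerDl ltW.
by rewrite addrC addKr mulrAC divff ?mul1r ?gt_eqF.
Qed.

Lemma firing_set_lbound t : lbound (firing_set sigma f t) t.
Proof. by move=> x [/ltW]. Qed.

Lemma firing_map_le t t' : firing_set sigma f t t' -> firing_map sigma f t <= t'.
Proof. by move=> tt'; apply: ge_inf => //; exists t; exact: firing_set_lbound. Qed.

Lemma le_firing_map t x : lbound (firing_set sigma f t) x -> x <= firing_map sigma f t.
Proof.
by move=> xlb; apply: lb_le_inf => //; exists (t + varsigma^-1); exact: firing_setD.
Qed.

(** A firing time [t'] for the later start [t] is one for the earlier start [s]: the
    threshold [expR (sigma * s)] is lower and the input on [[s, t]] is
    nonnegative. *)
Lemma firing_map_homo s t : s <= t -> firing_map sigma f s <= firing_map sigma f t.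
Proof.
move=> st; apply: le_firing_map => t' [tt' Jt'].
apply: firing_map_le; split; first exact: le_lt_trans tt'.
have v0 := ltW varsigma_gt0.
rewrite -/(net_input _ _ _ _) (net_inputD _ f_loc st (ltW tt')).
have := net_input_ge0 sigma_ge0 v0 f_loc f_ge st.
have : expR (sigma * s) <= expR (sigma * t) by rewrite ler_expR ler_wpM2l.
move: Jt'; rewrite -/(net_input _ _ _ _); lra.
Qed.

(** If [s'] is a firing time for the start [s], then [Num.max s' t + e] is one for
    the start [t]: the input gained during the extra time [e] covers both the
    input lost on [[s, t]] and the rise of the threshold. *)
Lemma firing_map_le_add s t e : s <= t -> 0 < e ->
  net_input sigma f s t + expR (sigma * t) - expR (sigma * s) <=
    varsigma * e * expR (sigma * s) ->
  firing_map sigma f t <= firing_map sigma f s + (t - s) + e.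
Proof.
move=> st e0 small.
rewrite -lerBlDr -lerBlDr.
apply: le_firing_map => s' [ss' Js'].
(* [s'] may precede [t], hence the maximum. *)
pose m := Num.max s' t.
have [s'm tm] : s' <= m /\ t <= m by rewrite !le_max !lexx orbT.
have mE : m <= s' + (t - s) by rewrite ge_max; apply/andP; split; lra.
suff : firing_map sigma f t <= m + e by move: mE; clear; lra.
apply: firing_map_le; split; first lra.
rewrite -/(net_input _ _ _ _); move: Js'; rewrite -/(net_input _ _ _ _) => Js'.
have v0 := ltW varsigma_gt0.
have me : m <= m + e by lra.
have sm : s <= m by lra.
have := net_inputD sigma f_loc st (le_trans tm me).
rewrite (net_inputD sigma f_loc sm me) (net_inputD sigma f_loc (ltW ss') s'm).
have := net_input_ge0 sigma_ge0 v0 f_loc f_ge s'm.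
have := net_input_ge sigma_ge0 v0 f_loc f_ge me; rewrite [m + e]addrC addrK.
have : varsigma * expR (sigma * s) * e <= varsigma * expR (sigma * m) * e.
  by rewrite ler_wpM2r ?(ltW e0)// ler_wpM2l// ler_expR ler_wpM2l.
rewrite mulrAC in small *.
lra.
Qed.

(** The hypothesis is the conclusion of [net_input_small] for [e = 1]: as the growth
    of the threshold is nonnegative, it keeps the input below [expR (sigma * s)] on
    any interval shorter than [d]. *)
Lemma displacement_ge d : (forall s t : R, s <= t -> t - s < d ->
    net_input sigma f s t + expR (sigma * t) - expR (sigma * s) <
    1 * expR (sigma * s)) ->
  forall t, d <= displacement_map sigma f t.
Proof.
move=> small t; rewrite lerBrDr; apply: le_firing_map => t' [tt'].
rewrite -/(net_input _ _ _ _) leNgt => Jt'; rewrite leNgt; apply/negP => t'd.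
have t'td : t' - t < d by rewrite ltrBlDr.
have : expR (sigma * t) <= expR (sigma * t').
  by rewrite ler_expR ler_wpM2l// ltW.
by have := small _ _ (ltW tt') t'td; move: Jt'; rewrite -leNgt; lra.
Qed.

Lemma displacement_itv t : 0 <= displacement_map sigma f t <= varsigma^-1.
Proof.
rewrite subr_ge0 lerBlDr addrC firing_map_le ?andbT; last exact: firing_setD.
exact/le_firing_map/firing_set_lbound.
Qed.

(** For [s <= t], [firing_map_homo] and [firing_map_le_add] enclose the difference
    of the displacements at [t] and [s] between [- (t - s)] and [e / 2]. *)
Lemma displacement_unif_continuous :
  (forall e : R, 0 < e -> exists2 d : R, 0 < d &
    forall s t : R, s <= t -> t - s < d ->
    net_input sigma f s t + expR (sigma * t) - expR (sigma * s) <
    e * expR (sigma * s)) ->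
  unif_continuous (displacement_map sigma f).
Proof.
move=> small; apply/unif_continuousP => e e0.
have e20 : 0 < e / 2 by rewrite divr_gt0.
have [d d0 dP] := small _ (mulr_gt0 varsigma_gt0 e20).
exists (Num.min d e); first by rewrite lt_min d0.
move=> [s t]; rewrite /ball/= lt_min => /andP[].
wlog st : s t / s <= t.
  move=> H; have [/H//|/ltW ts] := leP s t.
  by move=> std ste; rewrite distrC; apply: H => //; rewrite distrC.
rewrite !(distrC _ t) ger0_norm ?subr_ge0// => std ste.
rewrite distrC.
have := firing_map_homo st.
have := firing_map_le_add st e20 (ltW (dP _ _ st std)).
rewrite ltr_norml /displacement_map.
move: (firing_map sigma f s) (firing_map sigma f t) => x y.
by move: st ste e0; clear => st ste e0 yle xy; apply/andP; split; lra.
Qed.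

End firing.

Theorem theorem4p11 (R : realType) (sigma varsigma : R) (f : R -> R)
    (sigma_ge0 : 0 <= sigma) (varsigma_gt0 : 0 < varsigma)
    (f_loc : locally_integrable [set: R] f)
    (f_sup : ereal_sup (range (fun s : R =>
        (\int[lebesgue_measure]_(u in `[s, (s + delta)%R]) (f u)%:E)%E))
      @[delta --> (0 : R)^'+] --> 0%E)
    (f_ge : {ae lebesgue_measure, forall t : R, varsigma <= f t - sigma}) :
  [/\ forall t : R, firing_defined sigma f t,
      bounded_fun (displacement_map sigma f),
      unif_continuous (displacement_map sigma f) &
      0 < inf (range (displacement_map sigma f))].
Proof.
have small := net_input_small sigma_ge0 varsigma_gt0 f_loc f_ge
  (Rintegral_small f_loc f_sup).
split.
- by move=> t; exists (t + varsigma^-1); exact: firing_setD.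
- exists varsigma^-1; split; first exact: num_real.
  move=> M vM t _ /=.
  have /andP[D0 Dv] := displacement_itv sigma_ge0 varsigma_gt0 f_loc f_ge t.
  by rewrite ger0_norm// (le_trans Dv)// ltW.
- exact: (displacement_unif_continuous sigma_ge0 varsigma_gt0 f_loc f_ge small).
- have [d d0 dP] := small 1 ltr01.
  apply: (lt_le_trans d0); apply: lb_le_inf.
    by exists (displacement_map sigma f 0), 0.
  by move=> _ [t _ <-]; exact: (displacement_ge sigma_ge0 varsigma_gt0 f_loc f_ge).
Qed.
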